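(* Let $K$ be a field with a nonarchimedean valuation $\mathrm{val}:K^*\to\mathbb{R}$ whose residue field has characteristic different from $2$ and $3$; extend $\mathrm{val}$ to $\overline{K}$. Let $f$ be a nonsingular ternary cubic over $K$ with $\mathrm{val}(j(f))<0$. Let $M_1,\ldots,M_{432}$ be the $3\times 3$ matrices over $\overline{K}$ constructed from $f$ as described in the context. Then for at least one index $i\in\{1,\ldots,432\}$ the cubic $f\circ M$, with $M=M_i^{-1}$, is a symmetric honeycomb cubic (so testing the finitely many matrices produces a matrix $M$ over $\overline K$ such that $f\circ M$ is in symmetric honeycomb form).
   Context: Honeycomb form: a ternary cubic $f = c_{300}x^3+c_{210}x^2y+c_{120}xy^2+c_{030}y^3+c_{021}y^2z+c_{012}yz^2+c_{003}z^3+c_{102}xz^2+c_{201}x^2z+c_{111}xyz$ is in honeycomb form if the following nine scalars have positive valuation (denominators nonzero; $\mathrm{val}(0)=\infty$): (A) $\frac{c_{021}c_{102}}{c_{111}c_{012}},\ \frac{c_{012}c_{120}}{c_{111}c_{021}},\ \frac{c_{201}c_{012}}{c_{111}c_{102}},\ \frac{c_{210}c_{021}}{c_{111}c_{120}},\ \frac{c_{102}c_{210}}{c_{111}c_{201}},\ \frac{c_{120}c_{201}}{c_{111}c_{210}}$; (B) $\frac{c_{111}c_{003}}{c_{012}c_{102}},\ \frac{c_{111}c_{030}}{c_{021}c_{120}},\ \frac{c_{111}c_{300}}{c_{201}c_{210}}$. It is in symmetric honeycomb form if moreover the six scalars in (A) have the same valuation and the three scalars in (B) have the same valuation (possibly $\infty$).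 The $j$-invariant is the usual one of the elliptic curve $V(f)\subset \mathbb{P}^2$. For an invertible $3\times 3$ matrix $M$, $(f\circ M)(x,y,z)=f(M(x,y,z)^T)$. Construction. Put $\iota=j(f)$. Choose $a\in K$ with $\mathrm{val}(a)+\mathrm{val}(\iota)>0$ and $b\in\overline{K}$ such that the cubic $g=a(x^3+y^3+z^3)+b(x^2y+x^2z+xy^2+xz^2+y^2z+yz^2)+xyz$ satisfies $j(g)=\iota$ and is in symmetric honeycomb form (such $b$ exists). Let $\omega=\frac{3a+6b+1}{-3a+3b-1}$, let $w=\omega^{1/3}$ be a fixed cube root, and let $\xi\in\overline K$ be a primitive third root of unity. Let $a_1,\ldots,a_9\in\mathbb{P}^2$ be the points $a_1=(1:-1:0)$, $a_2=(1:0:-1)$, $a_3=(0:1:-1)$, $a_4=(1+w:1+\xi w:1+\xi^2w)$, $a_5=(1+\xi w:1+\xi^2w:1+w)$, $a_6=(1+\xi^2w:1+w:1+\xi w)$, $a_7=(1+\xi w:1+w:1+\xi^2w)$, $a_8=(1+w:1+\xi^2w:1+\xi w)$, $a_9=(1+\xi^2w:1+\xi w:1+w)$; these are the nine inflection points of $V(g)$, and $a_i,a_j,a_k$ are collinear exactly when $ijk$ is in the list $$123,147,159,168,249,258,267,348,357,369,456,789.$$ Let $\mathcal{A}_\omega=\{a_1,\ldots,a_9\}$, and let $\mathcal{B}=\{b_1,\ldots,b_9\}$ be the set of inflection points of $V(f)$ over $\overline K$, labeled so that $b_i,b_j,b_k$ are collinear if and only if $ijk$ is in this list. There are exactly $432$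 bijections $\pi_1,\ldots,\pi_{432}:\mathcal{B}\to\mathcal{A}_\omega$ respecting collinearity of triples. For each $i$ let $\sigma_i:\mathbb{P}^2\to\mathbb{P}^2$ be the unique projective transformation with $\sigma_i(b_k)=\pi_i(b_k)$ for $k=1,2,4,5$, and let $M_i$ be the $3\times3$ matrix over $\overline{K}$ (unique up to scaling) representing $\sigma_i$. *)

(* Defs.v *)
From HB Require Import structures.
From mathcomp Require Import all_boot all_order all_algebra ring_quotient.
From mathcomp Require Import all_fingroup.
From mathcomp Require Import boolp classical_sets reals constructive_ereal.
(* The notations of mpoly are incompatible with those of classical_sets. *)
From mathcomp Require Import -(notations) mpoly.

Set Implicit Arguments.
Unset Strict Implicit.
Unset Printing Implicit Defensive.

Import Order.TTheory GRing.Theory Num.Theory.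
Local Open Scope ring_scope.

(* A nonarchimedean valuation K^* -> R, extended to K by val 0 = +oo. *)
Record valuation (K : fieldType) (R : realType) := Valuation {
  val_of :> K -> \bar R;
  val_0 : val_of 0 = +oo%E;
  val_fin : forall x, x != 0 -> val_of x \is a fin_num;
  val_M : forall x y, val_of (x * y) = (val_of x + val_of y)%E;
  val_D : forall x y, (Order.min (val_of x) (val_of y) <= val_of (x + y)%R)%E
}.

Section ResidueField.
Variables (K : fieldType) (R : realType) (v : valuation K R).

Lemma val_1 : v 1 = 0%E.
Proof.
have := val_fin v (oner_neq0 K); have := val_M v 1 1; rewrite mulr1.
case: (v 1) => // r [/eqP]; rewrite -subr_eq0 opprD addrA subrr add0r oppr_eq0.
by move/eqP->.
Qed.

Lemma val_N x : v (- x) = v x.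
Proof.
have vN1 : v (- 1) = 0%E.
  have N1 : - 1 != 0 :> K by rewrite oppr_eq0 oner_neq0.
  have := val_fin v N1; have := val_M v (- 1) (- 1); rewrite mulrNN mulr1 val_1.
  case: (v (- 1)) => // r [/esym/eqP]; rewrite -mulr2n mulrn_eq0 /=.
  by move/eqP->.
by rewrite -mulN1r val_M vN1 add0e.
Qed.

Definition valuation_ring : {pred K} := fun x => (0 <= v x)%E.

Lemma valuation_ring_subring : subring_closed valuation_ring.
Proof.
split=> [|x y|x y]; first by rewrite unfold_in val_1.
  rewrite !unfold_in => x0 y0.
  by apply: le_trans (val_D v x (- y)); rewrite val_N le_min x0 y0.
by rewrite !unfold_in val_M => x0 y0; apply: adde_ge0.
Qed.
HB.instance Definition _ :=
  GRing.isSubringClosed.Build K valuation_ring valuation_ring_subring.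

Record valring := Valring { valring_val :> K; _ : valring_val \in valuation_ring }.
HB.instance Definition _ := [isSub for valring_val].
HB.instance Definition _ := [Choice of valring by <:].
HB.instance Definition _ := [SubChoice_isSubComNzRing of valring by <:].

Definition maximal_ideal : {pred valring} := fun x => (0 < v (val x))%E.

Lemma maximal_idealP : idealr_closed maximal_ideal.
Proof.
split.
- by rewrite unfold_in rmorph0 val_0 ltry.
- by rewrite unfold_in rmorph1 val_1 ltxx.
- move=> a x y; rewrite !unfold_in rmorphD rmorphM => x0 y0.
  apply: lt_le_trans (val_D v _ _); rewrite lt_min y0 andbT val_M.
  by have := valP a; rewrite unfold_in => a0; apply: lt_le_trans x0 _; rewrite leeDr.
Qed.
HB.instance Definition _ :=
  isIdealr.Build valring maximal_ideal maximal_idealP.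

Definition residue_field : comNzRingType := {ideal_quot maximal_ideal}.

End ResidueField.

Section PlaneCubics.
Variable L : closedFieldType.
Local Notation cubic := (mpoly 3 L).
Local Notation X i := (mpolyX L (mnm1 (i : 'I_3))).
Implicit Types (f : cubic) (M : 'M[L]_3) (p q : 'cV[L]_3).

(* (f o M)(x,y,z) = f(M(x,y,z)^T) *)
Definition subst_mx f M : cubic :=
  comp_mpoly [tuple \sum_(j < 3) M i j *: X j | i < 3] f.

Definition eval_at f p : L := meval (fun i => p i 0) f.

(* Points of P^2 are represented by nonzero column vectors. *)
Definition same_point p q := exists2 c : L, c != 0 & p = c *: q.

Definition nonsingular f :=
  forall p, p != 0 -> eval_at f p = 0 -> exists i, eval_at (mderiv i f) p != 0.

Definition collinear p1 p2 p3 :=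
  exists l : 'rV[L]_3, [/\ l != 0, l *m p1 = 0, l *m p2 = 0 & l *m p3 = 0].

(* The line {p + t q} meets V(f) at p (t = 0) with multiplicity at least 3.
   At a smooth point of V(f) such a line is the tangent line. *)
Definition inflection_point f p :=
  p != 0 /\ exists q : 'cV[L]_3,
    (forall c : L, q != c *: p) /\
    'X^3 %| mmap (@polyC L) (fun i => (p i 0)%:P + q i 0 *: 'X) f.

Definition weierstrass (a1 a2 a3 a4 a6 : L) : cubic :=
  let x := X 0 in let y := X 1 in let z := X 2%:R in
  y ^+ 2 * z + a1 *: (x * y * z) + a3 *: (y * z ^+ 2)
  - (x ^+ 3 + a2 *: (x ^+ 2 * z) + a4 *: (x * z ^+ 2) + a6 *: z ^+ 3).

Definition weierstrass_c4 (a1 a2 a3 a4 : L) : L :=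
  (a1 ^+ 2 + 4 * a2) ^+ 2 - 24 * (2 * a4 + a1 * a3).

Definition weierstrass_disc (a1 a2 a3 a4 a6 : L) : L :=
  let b2 := a1 ^+ 2 + 4 * a2 in
  let b4 := 2 * a4 + a1 * a3 in
  let b6 := a3 ^+ 2 + 4 * a6 in
  let b8 := a1 ^+ 2 * a6 + 4 * a2 * a6 - a1 * a3 * a4 + a2 * a3 ^+ 2 - a4 ^+ 2 in
  - b2 ^+ 2 * b8 - 8 * b4 ^+ 3 - 27 * b6 ^+ 2 + 9 * b2 * b4 * b6.

(* j is c4^3 / Delta for some Weierstrass equation of the plane cubic V(f). *)
Definition is_jinv f (j : L) :=
  exists M (c a1 a2 a3 a4 a6 : L),
    let D := weierstrass_disc a1 a2 a3 a4 a6 in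
    [/\ M \in unitmx, c != 0, subst_mx f M = c *: weierstrass a1 a2 a3 a4 a6,
        D != 0 & j = weierstrass_c4 a1 a2 a3 a4 ^+ 3 / D].

(* Every nonsingular cubic over L has a Weierstrass equation and all of them
   have the same c4^3 / Delta, so j is well defined; on other cubics the value
   is the irrelevant default 0. *)
Definition jinv f : L := xget 0 [set j | is_jinv f j]%classic.

Section Honeycomb.
Variables (R : realType) (v : valuation L R).

Definition coef f (i j k : nat) : L := mcoeff (Multinom [tuple i; j; k]) f.

Definition honeycomb_denominators f : seq L :=
  let c := coef f in
  [:: c 1 1 1; c 0 1 2; c 0 2 1; c 1 0 2; c 1 2 0; c 2 0 1; c 2 1 0]%N.

Definition honeycomb_A f : seq L :=
  let c := coef f in
  [:: (c 0 2 1 * c 1 0 2) / (c 1 1 1 * c 0 1 2);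
      (c 0 1 2 * c 1 2 0) / (c 1 1 1 * c 0 2 1);
      (c 2 0 1 * c 0 1 2) / (c 1 1 1 * c 1 0 2);
      (c 2 1 0 * c 0 2 1) / (c 1 1 1 * c 1 2 0);
      (c 1 0 2 * c 2 1 0) / (c 1 1 1 * c 2 0 1);
      (c 1 2 0 * c 2 0 1) / (c 1 1 1 * c 2 1 0)]%N.

Definition honeycomb_B f : seq L :=
  let c := coef f in
  [:: (c 1 1 1 * c 0 0 3) / (c 0 1 2 * c 1 0 2);
      (c 1 1 1 * c 0 3 0) / (c 0 2 1 * c 1 2 0);
      (c 1 1 1 * c 3 0 0) / (c 2 0 1 * c 2 1 0)]%N.

Definition honeycomb f :=
  {in honeycomb_denominators f, forall s, s != 0} /\
  {in honeycomb_A f ++ honeycomb_B f, forall s, (0 < v s)%E}.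

Definition symmetric_honeycomb f :=
  [/\ honeycomb f,
      {in honeycomb_A f &, forall s t, v s = v t} &
      {in honeycomb_B f &, forall s t, v s = v t}].

End Honeycomb.

Definition symmetric_cubic (a b : L) : cubic :=
  let x := X 0 in let y := X 1 in let z := X 2%:R in
  a *: (x ^+ 3 + y ^+ 3 + z ^+ 3)
  + b *: (x ^+ 2 * y + x ^+ 2 * z + x * y ^+ 2 + x * z ^+ 2 + y ^+ 2 * z + y * z ^+ 2)
  + x * y * z.

Definition omega (a b : L) : L := (3 * a + 6 * b + 1) / (- 3 * a + 3 * b - 1).

Definition point (x y z : L) : 'cV[L]_3 := \col_i [tuple x; y; z]`_i.

(* The points a_1, ..., a_9; index i : 'I_9 stands for the label i.+1. *)
Definition apoint (w xi : L) (i : 'I_9) : 'cV[L]_3 :=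
  let u := 1 + w in let u' := 1 + xi * w in let u'' := 1 + xi ^+ 2 * w in
  [tuple point 1 (- 1) 0; point 1 0 (- 1); point 0 1 (- 1);
         point u u' u''; point u' u'' u; point u'' u u';
         point u' u u''; point u u'' u'; point u'' u' u]`_i.

End PlaneCubics.

Definition lines : seq (seq nat) :=
  [:: [:: 1; 2; 3]; [:: 1; 4; 7]; [:: 1; 5; 9]; [:: 1; 6; 8];
      [:: 2; 4; 9]; [:: 2; 5; 8]; [:: 2; 6; 7]; [:: 3; 4; 8];
      [:: 3; 5; 7]; [:: 3; 6; 9]; [:: 4; 5; 6]; [:: 7; 8; 9]]%N.

Definition on_line (i j k : 'I_9) : bool :=
  has (perm_eq [:: i.+1; j.+1; k.+1]) lines.

Section Labelings.
Variable L : closedFieldType.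
Implicit Types (f : mpoly 3 L) (a b : 'I_9 -> 'cV[L]_3).

(* b_1, ..., b_9 are the inflection points of V(f), without repetition. *)
Definition inflection_labeling f b :=
  [/\ forall i, inflection_point f (b i),
      forall i j, same_point (b i) (b j) -> i = j,
      forall p, inflection_point f p -> exists i, same_point p (b i) &
      forall i j k, uniq [:: i; j; k] ->
        (collinear (b i) (b j) (b k) <-> on_line i j k)].

(* The bijection b_i |-> a_(s i) respects collinearity of triples. *)
Definition respects_collinearity b a (s : 'S_9) :=
  forall i j k, uniq [:: i; j; k] ->
    (collinear (b i) (b j) (b k) <-> collinear (a (s i)) (a (s j)) (a (s k))).

(* M represents the projective transformation taking b_k to a_(s k) for the
   labels k = 1, 2, 4, 5. *)
Definition represents b a (s : 'S_9) (M : 'M[L]_3) :=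
  M \in unitmx /\
  forall k : 'I_9, (k.+1 \in [:: 1; 2; 4; 5])%N ->
    same_point (M *m b k) (a (s k)).

End Labelings.

(* Main.v *)
Require Import Defs.
From HB Require Import structures.
From mathcomp Require Import all_boot all_order all_algebra all_fingroup.
From mathcomp Require Import boolp classical_sets reals constructive_ereal.
From mathcomp Require Import -(notations) mpoly.
From mathcomp Require Import ring.
Set Implicit Arguments.
Unset Strict Implicit.
Unset Printing Implicit Defensive.
Import Order.TTheory GRing.Theory Num.Theory.
Local Open Scope ring_scope.

(** The proof never computes a j-invariant; it compares Weierstrass equations.

    Let [iota] be the common j-invariant of the cubic [fL] and of the symmetric
    cubic [g].  As [iota] has negative valuation, it is neither [0] nor [1728],
    and the integers [2] and [3] are invertible.  Both cubics have Weierstrass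
    equations with invariants [c4, c6, Delta] such that [c4 ^ 3 = iota * Delta]
    and [c6 ^ 2 = c4 ^ 3 - 1728 * Delta], so the quotient [c4 ^ 3 / c6 ^ 2] is
    the same for the two equations; since [c4] and [c6] are nonzero, a rescaling
    of the coordinates takes one pair [(c4, c6)] to the other.  This gives an
    invertible matrix [N] and a nonzero [c] such that [fL o N = c g]
    ([same_jinv_proj_equiv]).

    The points [a_1, ..., a_9] are inflection points of [V(g)]
    ([inflection_point_apoint]) and are pairwise distinct ([apoint_inj]): these
    are elementary computations once one knows that a few small perturbations
    of [1] and [-1] do not vanish, which is what the positive valuations of [a]
    and [b] provide.  Hence the [N a_i] are nine distinct inflection points of
    [V(fL)], that is, all of them, and they match [b_1, ..., b_9] up to a
    permutation [s] ([exists_labeling_perm]).  An invertible matrix preserves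
    collinearity, so [s] is one of the 432 bijections, say the [i]-th.

    Finally [N^-1] and [M_i] agree on [b_1, b_2, b_4, b_5], no three of which
    are collinear; four such points determine a projective transformation, so
    [M_i^-1] is a multiple of [N] ([represents_unique]).  Then [fL o M_i^-1] is
    a multiple of [g], and the symmetric honeycomb conditions only involve
    quotients that are homogeneous of degree [0] in the coefficients
    ([symmetric_honeycombZ]). *)

(** * Linear substitutions in ternary forms *)

Section Substitution.
Variable L : closedFieldType.
Implicit Types (f g h : mpoly 3 L) (M N T : 'M[L]_3) (p q : 'cV[L]_3).

Lemma mmap_comp_mpoly (S : comNzRingType) (phi : {rmorphism L -> S}) n k
    (t : n.-tuple (mpoly k L)) (y : 'I_k -> S) (f : mpoly n L) :
  mmap phi y (comp_mpoly t f) = mmap phi (fun i => mmap phi y (tnth t i)) f.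
Proof.
rewrite comp_mpolyE rmorph_sum; apply: eq_bigr => m _ /=.
rewrite mmapZ rmorph_prod /mmap1; congr (_ * _).
by apply: eq_bigr => i _; rewrite rmorphXn.
Qed.

(** Both the composition law of substitutions and the behaviour of inflection
    points under substitution are instances of this evaluation rule. *)
Lemma mmap_subst_mx (S : comNzRingType) (phi : {rmorphism L -> S})
    (y : 'I_3 -> S) f M :
  mmap phi y (subst_mx f M) = mmap phi (fun i => \sum_j phi (M i j) * y j) f.
Proof.
rewrite mmap_comp_mpoly; congr mmap; apply/boolp.funext => i.
rewrite tnth_mktuple rmorph_sum; apply: eq_bigr => j _ /=.
by rewrite mmapZ mmapX mmap1U.
Qed.

Lemma subst_mxE f M :
  subst_mx f M =
  mmap (@mpolyC 3 L) (fun i => \sum_j mpolyC 3 (M i j) * mpolyX L (mnm1 j)) f.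
Proof.
rewrite /subst_mx /comp_mpoly; congr mmap; apply/boolp.funext => i.
by rewrite tnth_mktuple; apply: eq_bigr => j _; rewrite mul_mpolyC.
Qed.

Lemma subst_mxM f M N : subst_mx (subst_mx f M) N = subst_mx f (M *m N).
Proof.
rewrite [LHS]subst_mxE mmap_subst_mx subst_mxE; congr mmap.
apply/boolp.funext => i; under eq_bigr do rewrite mulr_sumr.
rewrite exchange_big; apply: eq_bigr => k _ /=.
rewrite mxE rmorph_sum mulr_suml; apply: eq_bigr => j _ /=.
by rewrite rmorphM /= mulrA.
Qed.

Lemma subst_mx1 f : subst_mx f 1%:M = f.
Proof.
rewrite subst_mxE -[RHS](comp_mpoly_id f) /comp_mpoly; congr mmap.
apply/boolp.funext => i; rewrite tnth_mktuple (bigD1 i) //= big1 => [|j /negPf ij].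
  by rewrite mxE eqxx mul1r addr0.
by rewrite mxE eq_sym ij mul0r.
Qed.

Lemma subst_mxZ c f M : subst_mx (c *: f) M = c *: subst_mx f M.
Proof. exact: comp_mpolyZ. Qed.

Lemma sum_ord3 (V : nmodType) (F : 'I_3 -> V) :
  \sum_i F i = F 0 + F 1 + F 2%:R.
Proof.
rewrite !big_ord_recr big_ord0 /= add0r.
by congr (F _ + F _ + F _); apply: val_inj.
Qed.

(** The polynomial expression behind [symmetric_cubic], over any commutative
    ring: the same formula is needed for scalars, for polynomials in a
    parameter of a line and for ternary forms. *)
Definition symmetric_form (T : comNzRingType) (a b x y z : T) :=
  a * (x ^+ 3 + y ^+ 3 + z ^+ 3)
  + b * (x ^+ 2 * y + x ^+ 2 * z + x * y ^+ 2 + x * z ^+ 2 + y ^+ 2 * z + y * z ^+ 2)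
  + x * y * z.

Lemma rmorph_symmetric_form (T S : comNzRingType) (F : {rmorphism T -> S}) a b x y z :
  F (symmetric_form a b x y z) = symmetric_form (F a) (F b) (F x) (F y) (F z).
Proof. by rewrite /symmetric_form !(rmorphD, rmorphM, rmorphXn). Qed.

Lemma mmap_symmetric_cubic (S : comNzRingType) (phi : {rmorphism L -> S})
    (y : 'I_3 -> S) a b :
  mmap phi y (symmetric_cubic a b) =
  symmetric_form (phi a) (phi b) (y 0) (y 1) (y 2%:R).
Proof.
rewrite /symmetric_cubic -!mul_mpolyC.
have := rmorph_symmetric_form (mmap phi y) (mpolyC 3 a) (mpolyC 3 b)
  (mpolyX L (mnm1 0)) (mpolyX L (mnm1 1)) (mpolyX L (mnm1 2%:R)).
by rewrite /= !mmapX !mmap1U !mmapC.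
Qed.

Lemma mmap_weierstrass (S : comNzRingType) (phi : {rmorphism L -> S})
    (y : 'I_3 -> S) a1 a2 a3 a4 a6 :
  mmap phi y (weierstrass a1 a2 a3 a4 a6) =
  let x := y 0 in let z := y 2%:R in let y := y 1 in
  y ^+ 2 * z + phi a1 * (x * y * z) + phi a3 * (y * z ^+ 2)
  - (x ^+ 3 + phi a2 * (x ^+ 2 * z) + phi a4 * (x * z ^+ 2) + phi a6 * z ^+ 3).
Proof.
rewrite /weierstrass !(mmapB, mmapD, mmapZ) !rmorphM /=.
by rewrite !mmapX !mmap1U.
Qed.

Lemma subst_mx_scalar_symmetric (a b l : L) :
  subst_mx (symmetric_cubic a b) l%:M = l ^+ 3 *: symmetric_cubic a b.
Proof.
rewrite subst_mxE mmap_symmetric_cubic /= !sum_ord3 !mxE /= !mulr1n !mulr0n /symmetric_cubic.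
rewrite /symmetric_form -!mul_mpolyC.
ring.
Qed.

End Substitution.

(** * Weierstrass equations with the same j-invariant *)

Section Weierstrass.
Variable L : closedFieldType.
Implicit Types (f g h : mpoly 3 L) (M N T : 'M[L]_3) (p q : 'cV[L]_3).

(** A nonzero value of [jinv] is not the default one. *)
Lemma is_jinv_jinv (f : mpoly 3 L) :
  jinv f != 0 -> is_jinv f (jinv f).
Proof. by rewrite /jinv; case: xgetP => [j -> //|_]; rewrite eqxx. Qed.

Definition mx_of_rows (r : seq (seq L)) : 'M[L]_3 := \matrix_(i, j) nth 0 (nth [::] r i) j.

Lemma det_mx_of_rows (a b c d e f g h i : L) :
  \det (mx_of_rows [:: [:: a; b; c]; [:: d; e; f]; [:: g; h; i]]) =
  a * (e * i - f * h) - b * (d * i - f * g) + c * (d * h - e * g).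
Proof.
rewrite (expand_det_row _ 0) sum_ord3 /cofactor !(expand_det_row _ 0).
rewrite !big_ord_recr !big_ord0 /cofactor !det_mx11 !mxE /=; ring.
Qed.

Definition weierstrass_c6 (a1 a2 a3 a4 a6 : L) : L :=
  let b2 := a1 ^+ 2 + 4 * a2 in
  let b4 := 2 * a4 + a1 * a3 in
  let b6 := a3 ^+ 2 + 4 * a6 in
  - b2 ^+ 3 + 36 * b2 * b4 - 216 * b6.

Lemma weierstrass_c4_c6 a1 a2 a3 a4 a6 :
  weierstrass_c6 a1 a2 a3 a4 a6 ^+ 2 =
    weierstrass_c4 a1 a2 a3 a4 ^+ 3 - 1728 * weierstrass_disc a1 a2 a3 a4 a6.
Proof. rewrite /weierstrass_c6 /weierstrass_c4 /weierstrass_disc; ring. Qed.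

(** When [6] is invertible every Weierstrass equation reduces to this form, so
    that the curve only depends on [c4] and [c6]. *)
Definition short_weierstrass (c4 c6 : L) : mpoly 3 L :=
  weierstrass 0 0 0 (- 27 * c4) (- 54 * c6).

(** The scalar [c] avoids extracting a cube root each time an equation is
    normalised. *)
Definition proj_equiv f g :=
  exists (N : 'M[L]_3) (c : L), [/\ N \in unitmx, c != 0 & subst_mx f N = c *: g].

Lemma proj_equiv_sym f g : proj_equiv f g -> proj_equiv g f.
Proof.
case=> N [c [N_unit c0 fN]]; exists (invmx N), c^-1.
rewrite unitmx_inv invr_eq0; split=> //; apply: (scalerI c0).
by rewrite -subst_mxZ -fN subst_mxM mulmxV // subst_mx1 scalerA mulfV // scale1r.
Qed.

Lemma proj_equiv_trans f g h : proj_equiv f g -> proj_equiv g h -> proj_equiv f h.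
Proof.
case=> N [c [N_unit c0 fN]] [P [d [P_unit d0 gP]]]; exists (N *m P), (c * d).
by rewrite unitmx_mul N_unit P_unit mulf_neq0 // -subst_mxM fN subst_mxZ gP scalerA.
Qed.

(** Completing the square in [y] and the cube in [x], with the denominators
    cleared so that the coordinate change has integral coefficients. *)
Lemma weierstrass_short a1 a2 a3 a4 a6 :
  (6 : L) != 0 ->
  proj_equiv (weierstrass a1 a2 a3 a4 a6)
    (short_weierstrass (weierstrass_c4 a1 a2 a3 a4) (weierstrass_c6 a1 a2 a3 a4 a6)).
Proof.
move=> n6; pose b2 := a1 ^+ 2 + 4 * a2.
exists (mx_of_rows [:: [:: 6; 0; - 18 * b2];
                       [:: - 3 * a1; 1; 9 * a1 * b2 - 108 * a3];
                       [:: 0; 0; 216]]), 216.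
have n216 : (216 : L) != 0 by rewrite (_ : 216 = 6 ^+ 3) ?expf_neq0 //; ring.
split=> //.
  rewrite unitmxE det_mx_of_rows unitfE.
  rewrite (_ : _ + _ = 6 * 216); first exact: mulf_neq0.
  ring.
rewrite subst_mxE mmap_weierstrass /= !sum_ord3 !mxE /=.
rewrite /short_weierstrass /weierstrass /weierstrass_c4 /weierstrass_c6.
rewrite -!mul_mpolyC /b2.
ring.
Qed.

(** The substitution [(x : y : z) |-> (u^2 x : u^3 y : z)]. *)
Lemma short_weierstrass_rescale c4 c6 u : u != 0 ->
  proj_equiv (short_weierstrass (u ^+ 4 * c4) (u ^+ 6 * c6)) (short_weierstrass c4 c6).
Proof.
move=> u0.
exists (mx_of_rows [:: [:: u ^+ 2; 0; 0]; [:: 0; u ^+ 3; 0]; [:: 0; 0; 1]]), (u ^+ 6).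
split; [|exact: expf_neq0|].
  rewrite unitmxE det_mx_of_rows unitfE (_ : _ + _ = u ^+ 5); first exact: expf_neq0.
  ring.
rewrite subst_mxE mmap_weierstrass /= !sum_ord3 !mxE /=.
rewrite /short_weierstrass /weierstrass -!mul_mpolyC. ring.
Qed.

(** With [r4 = c4 / c4'] and [r6 = c6 / c6'], equality of the j-invariants says
    [r6 ^ 2 = r4 ^ 3], so [r4] and [r6] are the fourth and sixth powers of a
    square root [u] of [r6 / r4]. The values [0] and [1728] of [j] are those
    where [c4] or [c6] vanishes and this quotient is meaningless. *)
Lemma same_jinv_proj_equiv f g j : (6 : L) != 0 -> j != 0 -> j != 1728 ->
  is_jinv f j -> is_jinv g j -> proj_equiv f g.
Proof.
move=> n6 j0 j1728.
move=> [M [c [a1 [a2 [a3 [a4 [a6 [Mu c0 fM D0 jE]]]]]]]].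
move=> [M' [c' [a1' [a2' [a3' [a4' [a6' [Mu' c0' gM D0' jE']]]]]]]].
have fW := weierstrass_short a1 a2 a3 a4 a6 n6.
have gW := weierstrass_short a1' a2' a3' a4' a6' n6.
have c6E := weierstrass_c4_c6 a1 a2 a3 a4 a6.
have c6E' := weierstrass_c4_c6 a1' a2' a3' a4' a6'.
set D := weierstrass_disc a1 a2 a3 a4 a6 in D0 jE c6E.
set D' := weierstrass_disc a1' a2' a3' a4' a6' in D0' jE' c6E'.
set c4 := weierstrass_c4 _ _ _ _ in fW jE c6E.
set c4' := weierstrass_c4 _ _ _ _ in gW jE' c6E'.
set c6 := weierstrass_c6 _ _ _ _ _ in fW c6E.
set c6' := weierstrass_c6 _ _ _ _ _ in gW c6E'.
have c4D : c4 ^+ 3 = j * D by rewrite jE divfK.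
have c4D' : c4' ^+ 3 = j * D' by rewrite jE' divfK.
have c6D : c6 ^+ 2 = (j - 1728) * D by rewrite c6E c4D; ring.
have c6D' : c6' ^+ 2 = (j - 1728) * D' by rewrite c6E' c4D'; ring.
have c40 : c4 != 0 by move: (mulf_neq0 j0 D0); rewrite -c4D expf_eq0.
have c40' : c4' != 0 by move: (mulf_neq0 j0 D0'); rewrite -c4D' expf_eq0.
have j1728' : j - 1728 != 0 by rewrite subr_eq0.
have c60 : c6 != 0 by move: (mulf_neq0 j1728' D0); rewrite -c6D expf_eq0.
have c60' : c6' != 0 by move: (mulf_neq0 j1728' D0'); rewrite -c6D' expf_eq0.
have [u uE] : exists u : L, u ^+ 2 = (c6 / c6') * (c4' / c4).
  have [u] := @solve_monicpoly L 2 (fun i => if i is 0 then (c6 / c6') * (c4' / c4) else 0) isT.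
  by rewrite !big_ord_recr big_ord0 /= => uE; exists u; rewrite uE; ring.
have u0 : u != 0.
  have : u ^+ 2 != 0 by rewrite uE !mulf_neq0 ?invr_eq0.
  by rewrite expf_eq0.
(* Both sides are [j * (j - 1728) * D * D']. *)
have c46 : c6 ^+ 2 * c4' ^+ 3 = c6' ^+ 2 * c4 ^+ 3 by rewrite c4D c4D' c6D c6D'; ring.
have u4 : u ^+ 4 * c4' = c4.
  rewrite (exprM u 2 2) uE.
  have -> : (c6 / c6' * (c4' / c4)) ^+ 2 * c4' = c6 ^+ 2 * c4' ^+ 3 / (c6' ^+ 2 * c4 ^+ 2).
    by field; rewrite c60' c40.
  by rewrite c46; field; rewrite c60' c40.
have u6 : u ^+ 6 * c6' = c6.
  rewrite (exprM u 2 3) uE.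
  have -> : (c6 / c6' * (c4' / c4)) ^+ 3 * c6' = (c6 ^+ 2 * c4' ^+ 3) * c6 / (c6' ^+ 2 * c4 ^+ 3).
    by field; rewrite c60' c40.
  by rewrite c46; field; rewrite c60' c40.
have := short_weierstrass_rescale c4' c6' u0; rewrite u4 u6 => ss'.
have fW0 : proj_equiv f (weierstrass a1 a2 a3 a4 a6) by exists M, c.
have gW0 : proj_equiv g (weierstrass a1' a2' a3' a4' a6') by exists M', c'.
apply: proj_equiv_trans fW0 _; apply: proj_equiv_trans fW _.
apply: proj_equiv_trans ss' _; apply: proj_equiv_sym.
exact: proj_equiv_trans gW0 gW.
Qed.

End Weierstrass.

(** * Inflection points of the symmetric cubic *)

Section Inflection.
Variable L : closedFieldType.
Implicit Types (f g h : mpoly 3 L) (M N T : 'M[L]_3) (p q : 'cV[L]_3).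

Lemma inflection_point_subst_mx f N p :
  N \in unitmx -> inflection_point (subst_mx f N) p -> inflection_point f (N *m p).
Proof.
move=> N_unit [p0 [q [q_notin fN]]]; split.
  by apply: contraNneq p0 => Np; rewrite -(mulKmx N_unit p) Np mulmx0.
exists (N *m q); split=> [c|].
  apply: contraNneq (q_notin c) => Nq.
  by rewrite -(mulKmx N_unit q) Nq -scalemxAr mulKmx.
move: fN; rewrite mmap_subst_mx; congr (_ %| mmap _ _ _).
apply/boolp.funext => i; rewrite !mxE rmorph_sum scaler_suml -big_split /=.
apply: eq_bigr => j _.
by rewrite mulrDr rmorphM /= -scalerA [_ * (_ *: _)]mul_polyC.
Qed.

Lemma inflection_pointZ f c p :
  inflection_point f p -> inflection_point (c *: f) p.
Proof.
move=> [p0 [q [pq fq]]]; split=> //; exists q; split=> //.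
by rewrite mmapZ dvdp_mull.
Qed.

(** The derivative of [symmetric_form a b] at [(x, y, z)] in the direction
    [(x', y', z')]. *)
Definition symmetric_polar (a b x y z x' y' z' : L) :=
  x' * (3 * a * x ^+ 2 + b * (2 * x * (y + z) + y ^+ 2 + z ^+ 2) + y * z)
  + y' * (3 * a * y ^+ 2 + b * (2 * y * (x + z) + x ^+ 2 + z ^+ 2) + x * z)
  + z' * (3 * a * z ^+ 2 + b * (2 * z * (x + y) + x ^+ 2 + y ^+ 2) + x * y).

(** For a cubic form [F], the expansion of [F (p + t q)] in [t] has the
    coefficients [F p], the derivative at [p] along [q], the derivative at [q]
    along [p], and [F q]. *)
Lemma inflection_symmetric_cubic (a b x y z x' y' z' : L) :
  Defs.point x y z != 0 -> (forall c, Defs.point x' y' z' != c *: Defs.point x y z) ->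
  symmetric_form a b x y z = 0 ->
  symmetric_polar a b x y z x' y' z' = 0 ->
  symmetric_polar a b x' y' z' x y z = 0 ->
  inflection_point (symmetric_cubic a b) (Defs.point x y z).
Proof.
move=> p0 qp C0 C1 C2; split=> //; exists (Defs.point x' y' z'); split=> //.
rewrite mmap_symmetric_cubic !mxE /=.
rewrite -!mul_polyC.
have -> : symmetric_form a%:P b%:P (x%:P + x'%:P * 'X) (y%:P + y'%:P * 'X) (z%:P + z'%:P * 'X)
  = (symmetric_form a b x y z)%:P + (symmetric_polar a b x y z x' y' z')%:P * 'X
    + (symmetric_polar a b x' y' z' x y z)%:P * 'X^2 + (symmetric_form a b x' y' z')%:P * 'X^3.
  rewrite /symmetric_form /symmetric_polar; ring.
by rewrite C0 C1 C2 !mul0r !add0r dvdp_mull.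
Qed.

(** In the coordinates [X0 = x + y + z], [X1 = x + xi^2 y + xi z],
    [X2 = x + xi y + xi^2 z], with [xi] a primitive cube root of unity, the
    symmetric cubic is [1/27] times the Hesse form
    [hesse_num a b X0^3 - hesse_den a b (X1^3 + X2^3) + 3 (6 a - 1) X0 X1 X2],
    so [- omega a b] is the quotient of its first two coefficients. *)
Definition hesse_num (a b : L) := 3 * a + 6 * b + 1.
Definition hesse_den (a b : L) := - 3 * a + 3 * b - 1.

Section SymmetricCubic.
Variables (a b : L).
Hypothesis n6 : (6 : L) != 0.

Lemma sum_point (x y z : L) : \sum_i Defs.point x y z i 0 = x + y + z.
Proof. by rewrite sum_ord3 !mxE. Qed.

(** In the coordinates [X0, X1, X2] described at [hesse_num] the point is
    [(1 : w : 0)], and the tangent there passes through [(m : - w m : n)].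
    In these coordinates all terms of degree at most [2] in [t] are multiples
    of [hesse_num a b - w^3 hesse_den a b]. *)
Lemma inflection_finite_point (xi w : L) :
  w != 0 -> 6 * a - 1 != 0 -> xi ^+ 2 = - 1 - xi ->
  w ^+ 3 * hesse_den a b = hesse_num a b ->
  inflection_point (symmetric_cubic a b)
    (Defs.point (1 + w) (1 + xi * w) (1 + xi ^+ 2 * w)).
Proof.
move=> w0 a6 xi2 wE; pose m := (6 * a - 1) * w; pose n := -2 * hesse_num a b.
have n0 : hesse_num a b - w ^+ 3 * hesse_den a b = 0 by rewrite wE subrr.
have [n2 n3] : (2 : L) != 0 /\ (3 : L) != 0.
  by apply/andP; move: n6; rewrite (_ : 6 = 2 * 3 :> L) ?mulf_eq0 ?negb_or //; ring.
apply: (@inflection_symmetric_cubic _ _ _ _ _ (m - w * m + n)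
  (m - xi * (w * m) + xi ^+ 2 * n) (m - xi ^+ 2 * (w * m) + xi * n)).
- apply: contraNneq n3 => p0; have := sum_point (1 + w) (1 + xi * w) (1 + xi ^+ 2 * w).
  rewrite p0 big1 => [|i _]; last by rewrite mxE.
  by move=> ->; apply/eqP; ring: xi2.
(* Comparing X0 and X1 gives 3 m = 3 c and - 3 w m = 3 w c, whence 6 w m = 0. *)
- move=> c; apply/eqP => /matrixP q_eq.
  have := (q_eq 0 0, q_eq 1 0, q_eq 2%:R 0).
  rewrite !mxE /= => -[[e0 e1] e2].
  have cm : 3 * m = 3 * c.
    transitivity ((m - w * m + n) + (m - xi * (w * m) + xi ^+ 2 * n)
                  + (m - xi ^+ 2 * (w * m) + xi * n)); first by ring: xi2.
    by rewrite e0 e1 e2; ring: xi2.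
  have cwm : - (3 * w * m) = 3 * w * c.
    transitivity ((m - w * m + n) + xi ^+ 2 * (m - xi * (w * m) + xi ^+ 2 * n)
                  + xi * (m - xi ^+ 2 * (w * m) + xi * n)); first by ring: xi2.
    by rewrite e0 e1 e2; ring: xi2.
  have : 6 * w * m = 0.
    transitivity (w * (3 * m) - - (3 * w * m)); first by ring.
    by rewrite cm cwm; ring.
  by apply/eqP; rewrite !mulf_neq0.
(* With e = hesse_num a b - w^3 hesse_den a b, the terms of degree 0, 1 and 2
   are e, - 3 m e and 3 m^2 e. *)
- rewrite -n0 /symmetric_form /hesse_num /hesse_den; ring: xi2.
- rewrite -(mulr0 (- 3 * m)) -n0 /symmetric_polar /m /n /hesse_num /hesse_den; ring: xi2.
- rewrite -(mulr0 (3 * m ^+ 2)) -n0 /symmetric_polar /m /n /hesse_num /hesse_den; ring: xi2.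
Qed.

(** Here the line [x + y + z = 0] plays the role of the line at infinity. The
    exchange of two coordinates fixes the cubic, maps the point [p] to [-p] and
    fixes the chosen direction [q], so the cubic restricted to [p + t q] is an
    odd polynomial in [t]; [q] is chosen to make the linear term vanish. *)
Lemma inflection_points_at_infinity : 2 * b - 1 != 0 ->
  let g := symmetric_cubic a b in
  [/\ inflection_point g (Defs.point 1 (- 1) 0),
      inflection_point g (Defs.point 1 0 (- 1))
    & inflection_point g (Defs.point 0 1 (- 1))].
Proof.
move=> b2 g; pose m := 2 * b - 1; pose n := - 2 * (3 * a - b).
have n2 : (2 : L) != 0.
  by move: n6; rewrite (_ : 6 = 2 * 3 :> L) ?mulf_eq0 ?negb_or => [/andP[]|] //; ring.
have not_prop c : m = c -> m = - c -> False.
  move=> mc mNc; have : 2 * m = 0 by rewrite mulr2n mulrDl !mul1r {1}mc mNc subrr.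
  by apply/eqP; rewrite mulf_neq0.
split; [apply: (@inflection_symmetric_cubic _ _ _ _ _ m m n)
       |apply: (@inflection_symmetric_cubic _ _ _ _ _ m n m)
       |apply: (@inflection_symmetric_cubic _ _ _ _ _ n m m)];
  try by rewrite /symmetric_form /symmetric_polar /m /n; ring.
- apply/eqP => /matrixP /(_ 0 0); rewrite !mxE /=; exact/eqP/oner_neq0.
- move=> c; apply/eqP => /matrixP pq; have := (pq 0 0, pq 1 0); rewrite !mxE /=.
  by case; rewrite mulr1 mulrN1; apply: not_prop.
- apply/eqP => /matrixP /(_ 0 0); rewrite !mxE /=; exact/eqP/oner_neq0.
- move=> c; apply/eqP => /matrixP pq; have := (pq 0 0, pq 2%:R 0); rewrite !mxE /=.
  by case; rewrite mulr1 mulrN1; apply: not_prop.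
- apply/eqP => /matrixP /(_ 1 0); rewrite !mxE /=; exact/eqP/oner_neq0.
- move=> c; apply/eqP => /matrixP pq; have := (pq 1 0, pq 2%:R 0); rewrite !mxE /=.
  by case; rewrite mulr1 mulrN1; apply: not_prop.
Qed.

(** The six last points form the orbit of a single family: replacing [w] by
    [xi^k w] and [xi] by [xi^2] permutes them transitively. *)
Lemma inflection_point_apoint (xi w : L) i :
  2 * b - 1 != 0 -> 6 * a - 1 != 0 -> w != 0 ->
  xi ^+ 2 = - 1 - xi -> w ^+ 3 * hesse_den a b = hesse_num a b ->
  inflection_point (symmetric_cubic a b) (apoint w xi i).
Proof.
move=> b2 a6 w0 xi2 wE.
have [inf1 inf2 inf3] := inflection_points_at_infinity b2.
have xi3 : xi ^+ 3 = 1 by ring: xi2.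
have xi0 : xi != 0 by apply: contraTneq (oner_neq0 L) => x0; rewrite -xi3 x0 expr0n eqxx.
have fin x k : x = xi \/ x = xi ^+ 2 ->
    inflection_point (symmetric_cubic a b)
      (Defs.point (1 + xi ^+ k * w) (1 + x * (xi ^+ k * w)) (1 + x ^+ 2 * (xi ^+ k * w))).
  move=> xE; apply: inflection_finite_point => //.
  - by rewrite mulf_neq0 ?expf_neq0.
  - by case: xE => -> //; ring: xi2.
  - by rewrite exprMn exprAC xi3 expr1n mul1r.
have pointE (x y z x' y' z' : L) : x = x' -> y = y' -> z = z' ->
  Defs.point x y z = Defs.point x' y' z' by move=> -> -> ->.
case: i => [[|[|[|[|[|[|[|[|[|i]]]]]]]]] lt_i] //; rewrite /apoint /=; clear lt_i.
- move: (fin xi 0%N (or_introl erefl)); congr (inflection_point _ _); apply: pointE; ring: xi2.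
- move: (fin xi 1%N (or_introl erefl)); congr (inflection_point _ _); apply: pointE; ring: xi2.
- move: (fin xi 2 (or_introl erefl)); congr (inflection_point _ _); apply: pointE; ring: xi2.
- move: (fin _ 1%N (or_intror erefl)); congr (inflection_point _ _); apply: pointE; ring: xi2.
- move: (fin _ 0%N (or_intror erefl)); congr (inflection_point _ _); apply: pointE; ring: xi2.
- move: (fin _ 2 (or_intror erefl)); congr (inflection_point _ _); apply: pointE; ring: xi2.
Qed.

End SymmetricCubic.

(** The sum of the coordinates normalises the last six points, so that
    proportional representatives are equal. *)
Lemma sum_apoint (w xi : L) i : xi ^+ 2 = - 1 - xi ->
  \sum_k apoint w xi i k 0 = if (i < 3)%N then 0 else 3.
Proof.
move=> xi2; rewrite sum_ord3 /apoint.
by case: i => [[|[|[|[|[|[|[|[|[|i]]]]]]]]] lt_i] //; rewrite !mxE /=; ring: xi2.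
Qed.

Lemma apoint_inj (w xi : L) i j :
  (3 : L) != 0 -> w != 0 -> 3.-primitive_root xi -> xi ^+ 2 = - 1 - xi ->
  same_point (apoint w xi i) (apoint w xi j) -> i = j.
Proof.
move=> n3 w0 xi_prim xi2 [c c0 ijc].
have := sum_apoint w i xi2; rewrite ijc.
under eq_bigr do rewrite mxE.
rewrite -mulr_sumr (sum_apoint w j xi2).
have [i3|i3] := ltnP i 3; have [j3|j3] := ltnP j 3.
- move=> _; move/matrixP: ijc => ijc.
  have := (ijc 0 0, ijc 1 0, ijc 2%:R 0); rewrite !mxE /apoint.
  case: i i3 {ijc} => [[|[|[|i]]] lt_i] // _; case: j j3 => [[|[|[|j]]] lt_j] // _;
    rewrite !mxE /= ?mulr0 ?mulr1 ?mulrN1 => -[[e0 e1] e2]; try exact: val_inj;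
    first [ by move/eqP: e0; rewrite oner_eq0
             | by move/esym/eqP: e0; rewrite (negPf c0)
             | by move/eqP: e1; rewrite oppr_eq0 oner_eq0
             | by move/esym/eqP: e1; rewrite oppr_eq0 (negPf c0) ].
- by move=> /eqP; rewrite (negPf (mulf_neq0 c0 n3)).
- by move=> /esym/eqP; rewrite mulr0 (negPf n3).
(* The first two coordinates, as exponents of xi, determine the label. *)
move=> c3; have c1 : c = 1 by apply: (mulIf n3); rewrite c3 mul1r.
move: ijc; rewrite c1 scale1r => /matrixP ij.
have xiE (k l : nat) : 1 + xi ^+ k * w = 1 + xi ^+ l * w -> k = l %[mod 3].
  by move=> /addrI/(mulIf w0)/eqP; rewrite (eq_prim_root_expr xi_prim) => /eqP.
pose e0 := [:: 0; 1; 2; 1; 0; 2]%N; pose e1 := [:: 1; 2; 0; 0; 2; 1]%N.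
have coordE (k : 'I_9) : (3 <= k)%N ->
    apoint w xi k 0 0 = 1 + xi ^+ nth 0%N e0 (k - 3) * w /\
    apoint w xi k 1 0 = 1 + xi ^+ nth 0%N e1 (k - 3) * w.
  case: k => [[|[|[|[|[|[|[|[|[|k]]]]]]]]] lt_k] // _; rewrite !mxE /= ?expr0 ?mul1r ?expr1 //.
have [i0 i1] := coordE i i3; have [j0 j1] := coordE j j3.
have := (ij 0 0, ij 1 0); rewrite i0 i1 j0 j1 => -[/xiE + /xiE].
move=> k0 k1; apply: val_inj; move: i3 j3 k0 k1 => /=; clear.
by case: i => [[|[|[|[|[|[|[|[|[|k]]]]]]]]] lt_k] //=; case: j => [[|[|[|[|[|[|[|[|[|l]]]]]]]]] lt_l].
Qed.

End Inflection.

(** * Projective points, lines and frames *)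

Section Projective.
Variable L : closedFieldType.
Implicit Types (f g h : mpoly 3 L) (M N T : 'M[L]_3) (p q : 'cV[L]_3).

Lemma same_point_sym (p q : 'cV[L]_3) :
  same_point p q -> same_point q p.
Proof.
by case=> c c0 ->; exists c^-1; rewrite ?invr_eq0 // scalerA mulVf // scale1r.
Qed.

Lemma same_point_trans (p q r : 'cV[L]_3) :
  same_point p q -> same_point q r -> same_point p r.
Proof.
by case=> c c0 -> [d d0 ->]; exists (c * d); rewrite ?mulf_neq0 // scalerA.
Qed.

Lemma same_point_mulmx (N : 'M[L]_3) (p q : 'cV[L]_3) :
  N \in unitmx -> same_point (N *m p) (N *m q) <-> same_point p q.
Proof.
move=> Nu; split=> -[c c0 E]; exists c => //; last by rewrite E scalemxAr.
by rewrite -(mulKmx Nu p) E -scalemxAr mulKmx.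
Qed.

Lemma collinear_same_point (p1 p2 p3 q1 q2 q3 : 'cV[L]_3) :
  same_point p1 q1 -> same_point p2 q2 -> same_point p3 q3 ->
  collinear p1 p2 p3 <-> collinear q1 q2 q3.
Proof.
move=> [c1 n1 ->] [c2 n2 ->] [c3 n3 ->].
have kill (l : 'rV[L]_3) c (q : 'cV[L]_3) : c != 0 -> l *m (c *: q) = 0 <-> l *m q = 0.
  move=> c0; rewrite -scalemxAr; split=> [/eqP|->]; last by rewrite scaler0.
  by rewrite scaler_eq0 (negPf c0) => /eqP.
by split=> -[l [l0 l1 l2 l3]]; exists l; split=> //;
  [exact/(kill _ _ _ n1)|exact/(kill _ _ _ n2)|exact/(kill _ _ _ n3)
  |exact/(kill _ _ _ n1)|exact/(kill _ _ _ n2)|exact/(kill _ _ _ n3)].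
Qed.

Lemma collinear_mulmx (N : 'M[L]_3) (p1 p2 p3 : 'cV[L]_3) :
  N \in unitmx -> collinear (N *m p1) (N *m p2) (N *m p3) <-> collinear p1 p2 p3.
Proof.
move=> Nu; split=> -[l [l0 l1 l2 l3]].
  exists (l *m N); rewrite -!mulmxA; split=> //.
  by apply: contraNneq l0 => lN; rewrite -(mulmxK Nu l) lN mul0mx.
exists (l *m invmx N); rewrite -!mulmxA !mulKmx //; split=> //.
by apply: contraNneq l0 => lN; rewrite -(mulmxKV Nu l) lN mul0mx.
Qed.

(** In the basis of eigenvectors given by the columns of [P], all coordinates
    of the eigenvector [q] are nonzero, so every eigenvalue equals [e]. *)
Lemma scalar_mx_of_frame (F : fieldType) n (T P : 'M[F]_n) (q : 'cV_n) d e :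
  P \in unitmx -> T *m P = P *m diag_mx d -> T *m q = e *: q ->
  (forall i, (invmx P *m q) i 0 != 0) -> T = e%:M.
Proof.
move=> P_unit TP Tq q_gen; suff dE : d = const_mx e.
  by rewrite -[T](mulmxK P_unit) TP dE diag_const_mx scalar_mxC mulmxK.
apply/rowP => i; rewrite mxE; apply: (mulIf (q_gen i)).
suff : diag_mx d *m (invmx P *m q) = e *: (invmx P *m q).
  by move/matrixP => /(_ i 0); rewrite mul_diag_mx !mxE.
apply: (can_inj (mulKmx P_unit)).
by rewrite mulmxA -TP -mulmxA mulKVmx // Tq -scalemxAr mulKVmx.
Qed.

(** The first three points form a basis, and the [i]-th coordinate of the
    fourth one vanishes only if it lies on the line through the other two
    basis points: that line is the [i]-th row of the inverse matrix. *)
Lemma scalar_mx_of_fixed_frame (T : 'M[L]_3) p1 p2 p3 p4 l1 l2 l3 l4 :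
  ~ collinear p1 p2 p3 -> ~ collinear p1 p2 p4 ->
  ~ collinear p1 p3 p4 -> ~ collinear p2 p3 p4 ->
  T *m p1 = l1 *: p1 -> T *m p2 = l2 *: p2 -> T *m p3 = l3 *: p3 ->
  T *m p4 = l4 *: p4 -> T = l4%:M.
Proof.
move=> n123 n124 n134 n234 T1 T2 T3 T4.
pose p (j : 'I_3) := [tuple p1; p2; p3]`_j.
pose d : 'rV[L]_3 := \row_j [tuple l1; l2; l3]`_j.
pose P : 'M[L]_3 := \matrix_(i, j) p j i 0.
have colP j : col j P = p j by apply/colP => i; rewrite !mxE.
have rowP (l : 'rV_3) j : l *m p j = ((l *m P) 0 j)%:M.
  by rewrite -colP colE mulmxA -colE; apply/matrixP => i k; rewrite !ord1 !mxE mulr1n.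
have P_unit : P \in unitmx.
  rewrite -row_free_unit -kermx_eq0; apply: contraT => /rowV0Pn[l].
  move=> /sub_kermxP lP l0; case: n123; exists l.
  have z j : l *m p j = 0 by rewrite rowP lP mxE raddf0.
  by split=> //; [apply: (z 0)|apply: (z 1)|apply: (z 2%:R)].
apply: (scalar_mx_of_frame P_unit (d := d) _ T4).
  apply/matrixP => i j; rewrite mul_mx_diag !mxE.
  have : T *m p j = d 0 j *: p j.
    by rewrite mxE; case: j => [[|[|[|j]]] lt_j].
  move/matrixP => /(_ i 0); rewrite !mxE mulrC => <-.
  by apply: eq_bigr => k _; rewrite !mxE.
move=> i; apply/eqP => qi; pose l := row i (invmx P).
have lp j : l *m p j = (i == j)%:R%:M.
  by rewrite rowP -row_mul mulVmx // !mxE.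
have l0 : l != 0.
  apply/eqP => l0; have /matrixP/(_ 0 0)/eqP := lp i.
  by rewrite l0 mul0mx !mxE !eqxx eq_sym oner_eq0.
have l4q : l *m p4 = 0.
  by rewrite -row_mul; apply/matrixP => k k'; rewrite !ord1 mxE qi mxE.
have lp0 j : i != j -> l *m p j = 0 by rewrite lp => /negPf ->; rewrite raddf0.
case: i @l qi lp l0 l4q lp0 => [[|[|[|i]]] lt_i] // l qi lp l0 l4q lp0.
- by apply: n234; exists l; split=> //; [apply: (lp0 1)|apply: (lp0 2%:R)].
- by apply: n134; exists l; split=> //; [apply: (lp0 0)|apply: (lp0 2%:R)].
- by apply: n124; exists l; split=> //; [apply: (lp0 0)|apply: (lp0 1)].
Qed.

(** Nine distinct inflection points exhaust the nine inflection points [B]. *)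
Lemma exists_labeling_perm (f : mpoly 3 L) (B a : 'I_9 -> 'cV[L]_3) :
  inflection_labeling f B -> (forall i, inflection_point f (a i)) ->
  (forall i j, same_point (a i) (a j) -> i = j) ->
  exists s : 'S_9, forall i, same_point (B i) (a (s i)).
Proof.
case=> _ _ B_all _ a_inf a_inj.
have /choice[t tP] i := B_all _ (a_inf i).
have t_inj : injective t.
  move=> i j tij; apply: a_inj; apply: same_point_trans (tP i) _.
  by rewrite tij; apply/same_point_sym/tP.
exists (perm t_inj)^-1%g => i; apply: same_point_sym.
by have := tP ((perm t_inj)^-1%g i); rewrite -[t _](permE t_inj) permKV.
Qed.

(** [N M] fixes the four points with labels [1, 2, 4, 5], and no three of these
    labels form one of the twelve lines. *)
Lemma represents_unique (f : mpoly 3 L) B a s (M N : 'M[L]_3) :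
  inflection_labeling f B -> represents B a s M -> N \in unitmx ->
  (forall i, same_point (B i) (N *m a (s i))) ->
  exists2 c : L, c != 0 & invmx M = N *m c%:M.
Proof.
case=> _ _ _ B_col [M_unit M_rep] N_unit BN.
have fixB (k : 'I_9) : (k.+1 \in [:: 1; 2; 4; 5])%N -> exists l, N *m M *m B k = l *: B k.
  move=> /M_rep[c c0 Mk]; have [d d0 Bk] := BN k.
  exists (c / d); rewrite -mulmxA Mk -scalemxAr -scalerA; congr (_ *: _).
  by rewrite Bk scalerA mulVf // scale1r.
pose lab k (lt_k : (k < 9)%N) : 'I_9 := Ordinal lt_k.
pose k1 := @lab 0 isT; pose k2 := @lab 1 isT; pose k4 := @lab 3 isT; pose k5 := @lab 4 isT.
have [[l1 T1] [l2 T2]] := (fixB k1 isT, fixB k2 isT).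
have [[l4 T4] [l5 T5]] := (fixB k4 isT, fixB k5 isT).
have general i j k : uniq [:: i; j; k] -> ~~ on_line i j k -> ~ collinear (B i) (B j) (B k).
  by move=> ijk nl /(B_col i j k ijk); apply/negP.
have NM : N *m M = l5%:M.
  apply: (scalar_mx_of_fixed_frame _ _ _ _ T1 T2 T4 T5); exact: general.
have l50 : l5 != 0.
  apply: contraTneq (oner_neq0 L) => l50.
  have := mulKmx N_unit M; rewrite NM l50 raddf0 mulmx0 => M0.
  have /matrixP/(_ 0 0)/eqP := mulmxV M_unit.
  by rewrite -M0 mul0mx !mxE eq_sym oner_eq0.
exists l5^-1; first by rewrite invr_eq0.
have -> : N = l5%:M *m invmx M by rewrite -NM mulmxK.
by rewrite -mulmxA -scalar_mxC -mulmxA -scalar_mxM mulVf // mulmx1.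
Qed.

End Projective.

(** * Valuations *)

Section Valuation.
Variables (K : fieldType) (R : realType) (v : valuation K R).

(** If [n] vanishes in [K], it vanishes in the valuation ring and then in its
    quotient. *)
Lemma residue_pchar_natr_neq0 n :
  prime n -> n \notin [pchar residue_field v] -> n%:R != 0 :> K.
Proof.
move=> n_pr; apply: contraNneq => n0; rewrite inE n_pr /=.
have n0' : n%:R = 0 :> valring v by apply: val_inj; rewrite rmorph_nat rmorph0.
have <- := rmorph_nat (\pi_({ideal_quot (maximal_ideal (v := v))})%qT : {rmorphism _ -> _}) n.
by rewrite n0' rmorph0.
Qed.

Lemma val_natr_ge0 n : (0 <= v n%:R)%E.
Proof. exact: (rpred_nat (valuation_ring v) n). Qed.

Lemma val_natrM_gt0 n x : (0 < v x)%E -> (0 < v (n%:R * x)%R)%E.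
Proof.
move=> x0; rewrite val_M; apply: lt_le_trans x0 _.
by rewrite leeDr // val_natr_ge0.
Qed.

Lemma val_addr_gt0 x y : (0 < v x)%E -> (0 < v y)%E -> (0 < v (x + y)%R)%E.
Proof. by move=> x0 y0; apply: lt_le_trans (val_D v x y); rewrite lt_min x0. Qed.

Lemma val_gt0_neq1 x : (0 < v x)%E -> x != 1.
Proof. by apply: contraTneq => ->; rewrite val_1 ltxx. Qed.

End Valuation.

(** * Honeycomb conditions *)

Section Honeycomb.
Variables (L : closedFieldType) (R : realType) (v : valuation L R).

(** All the quotients involved have as many coefficients in the numerator as in
    the denominator. *)
Lemma symmetric_honeycombZ (f : mpoly 3 L) c :
  c != 0 -> symmetric_honeycomb v f -> symmetric_honeycomb v (c *: f).
Proof.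
move=> c0.
have ratio (x y z t : L) : c * x * (c * y) / (c * z * (c * t)) = x * y / (z * t).
  by rewrite mulrACA [c * z * _]mulrACA -mulf_div divff ?mul1r ?mulf_neq0.
have cZ i j k : coef (c *: f) i j k = c * coef f i j k by rewrite /coef mcoeffZ.
have AE : honeycomb_A (c *: f) = honeycomb_A f.
  by rewrite /honeycomb_A !cZ; move: (coef f) => k; rewrite !ratio.
have BE : honeycomb_B (c *: f) = honeycomb_B f.
  by rewrite /honeycomb_B !cZ; move: (coef f) => k; rewrite !ratio.
move=> [[den pos] A B]; split; rewrite ?AE ?BE //; split; rewrite ?AE ?BE //.
have -> : honeycomb_denominators (c *: f) = [seq c * s | s <- honeycomb_denominators f].
  by rewrite /honeycomb_denominators !cZ.
by move=> _ /mapP[s /den s0 ->]; rewrite mulf_neq0.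
Qed.

(** Equality of exponents in a form that reduces by computation. *)
Lemma mnm3_eqE (m k : multinom 3) :
  (m == k) = [&& m 0 == k 0, m 1 == k 1 & m 2%:R == k 2%:R].
Proof.
apply/eqP/and3P => [->|[/eqP e0 /eqP e1 /eqP e2]]; first by rewrite !eqxx.
apply/mnmP => i; case: i => [[|[|[|i]]] lt_i] //.
- by move: e0; congr (m _ = k _); apply: val_inj.
- by move: e1; congr (m _ = k _); apply: val_inj.
- by move: e2; congr (m _ = k _); apply: val_inj.
Qed.

Lemma coef_symmetric_cubic (a b : L) :
  let c := coef (symmetric_cubic a b) in
  [/\ c 1%N 1%N 1%N = 1, c 0%N 2%N 1%N = b, c 1%N 0%N 2%N = b & c 0%N 1%N 2%N = b].
Proof.
rewrite /coef /symmetric_cubic.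
rewrite !mpolyXn -!mpolyXD.
split; rewrite !(mcoeffD, mcoeffZ, mcoeffX) !mnm3_eqE !(mnmDE, mulmnE, mnm1E);
  by rewrite !multinomE /= !(addr0, add0r, mulr0, mulr1).
Qed.

End Honeycomb.

(** * The matching of inflection points yields the honeycomb form *)

Theorem theorem4 (R : realType) (K : fieldType) (v : valuation K R)
    (char2 : 2%N \notin [pchar residue_field v])
    (char3 : 3%N \notin [pchar residue_field v])
    (L : closedFieldType) (incl : {rmorphism K -> L})
    (L_alg : forall x : L, algebraicOver incl x)
    (vL : valuation L R) (vL_ext : forall x : K, vL (incl x) = v x)
    (f : mpoly 3 K) (fL : mpoly 3 L) (fLE : fL = map_mpoly incl f)
    (f_cubic : f \is ishomog1 3 mdeg) (f_ns : nonsingular fL)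
    (f_j : (vL (jinv fL) < 0)%E)
    (a : K) (a_val : (0 < v a + vL (jinv fL))%E)
    (b : L) (g : mpoly 3 L) (gE : g = symmetric_cubic (incl a) b)
    (g_j : jinv g = jinv fL) (g_honeycomb : symmetric_honeycomb vL g)
    (w : L) (w_cube : w ^+ 3 = omega (incl a) b)
    (xi : L) (xi_prim : 3.-primitive_root xi)
    (B : 'I_9 -> 'cV[L]_3) (B_infl : inflection_labeling fL B)
    (pi : 'I_432 -> 'S_9) (pi_inj : injective pi)
    (pi_all : forall s : 'S_9,
       respects_collinearity B (apoint w xi) s <-> exists i, pi i = s)
    (M : 'I_432 -> 'M[L]_3)
    (M_rep : forall i, represents B (apoint w xi) (pi i) (M i)) :
  exists i : 'I_432, symmetric_honeycomb vL (subst_mx fL (invmx (M i))).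
Proof.
set iota := jinv fL in f_j a_val g_j.
have [n2 n3] : (2 : L) != 0 /\ (3 : L) != 0.
  by split; rewrite -(rmorph_nat incl) fmorph_eq0 (@residue_pchar_natr_neq0 _ _ v).
have n6 : (6 : L) != 0 by rewrite (_ : 6 = 2 * 3) ?mulf_neq0 //; ring.
have iota0 : iota != 0 by apply: contraTneq f_j => ->; rewrite val_0.
have iota1728 : iota != 1728.
  by apply: contraTneq f_j => ->; rewrite -leNgt val_natr_ge0.
have [N [c [N_unit c0 fN]]] : proj_equiv fL g.
  apply: (same_jinv_proj_equiv n6 iota0 iota1728); first exact: is_jinv_jinv.
  by rewrite -g_j; apply: is_jinv_jinv; rewrite g_j.
have va : (0 < vL (incl a))%E.
  rewrite vL_ext; have := a_val; rewrite !ltNge; apply: contra => a0.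
  by apply: adde_le0 => //; apply: ltW.
have [c111 c021 c102 c012] := coef_symmetric_cubic (incl a) b.
have [[den pos] _ _] := g_honeycomb.
have b0 : b != 0.
  by rewrite -c012 -gE den // !inE eqxx orbT.
(* The first quotient in [honeycomb_A g] simplifies to [b]. *)
have vb : (0 < vL b)%E.
  have := pos _ (mem_head _ _); rewrite gE c111 c021 c102 c012.
  by rewrite mul1r mulfK.
have b2 : 2 * b - 1 != 0 by rewrite subr_eq0 (val_gt0_neq1 (v := vL)) // val_natrM_gt0.
have a6 : 6 * incl a - 1 != 0 by rewrite subr_eq0 (val_gt0_neq1 (v := vL)) // val_natrM_gt0.
have num0 : hesse_num (incl a) b != 0.
  rewrite /hesse_num -oppr_eq0 opprD subr_eq0.
  by rewrite (val_gt0_neq1 (v := vL)) // val_N val_addr_gt0 ?val_natrM_gt0.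
have den0 : hesse_den (incl a) b != 0.
  rewrite /hesse_den subr_eq0 mulNr.
  by rewrite (val_gt0_neq1 (v := vL)) // val_addr_gt0 ?val_N ?val_natrM_gt0.
have omegaE : omega (incl a) b = hesse_num (incl a) b / hesse_den (incl a) b by [].
have w0 : w != 0.
  apply: contraTneq (mulf_neq0 num0 (invr_neq0 den0)) => w0.
  by rewrite -omegaE -w_cube w0 expr0n eqxx.
have wE : w ^+ 3 * hesse_den (incl a) b = hesse_num (incl a) b.
  by rewrite w_cube omegaE divfK.
have xi2 : xi ^+ 2 = - 1 - xi.
  have xi1 : xi - 1 != 0.
    rewrite subr_eq0 -[xi]expr1 -[1](expr0 xi).
    by rewrite (eq_prim_root_expr xi_prim).
  apply/eqP; rewrite -subr_eq0; apply/eqP/(mulfI xi1).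
  transitivity (xi ^+ 3 - 1); first by ring.
  by rewrite (prim_expr_order xi_prim) subrr mulr0.
(* As [fL o N = c g], the points [A i] are inflection points of [V(fL)]. *)
pose A i := N *m apoint w xi i.
have A_infl i : inflection_point fL (A i).
  apply: inflection_point_subst_mx => //; rewrite fN gE.
  apply: inflection_pointZ; exact: inflection_point_apoint.
have A_inj i j : same_point (A i) (A j) -> i = j.
  by move/(same_point_mulmx _ _ N_unit); apply: apoint_inj.
have [s sP] := exists_labeling_perm B_infl A_infl A_inj.
have s_resp : respects_collinearity B (apoint w xi) s.
  move=> i j k _; apply: iff_trans (collinear_mulmx _ _ _ N_unit).
  by apply: collinear_same_point; apply: sP.
have [i pi_i] := (pi_all s).1 s_resp.
have [|d d0 Mi] := represents_unique B_infl (M_rep i) N_unit; first by rewrite pi_i.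
exists i; rewrite Mi -subst_mxM fN gE subst_mxZ subst_mx_scalar_symmetric scalerA -gE.
by apply: symmetric_honeycombZ => //; rewrite mulf_neq0 ?expf_neq0.
Qed.
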